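(* Let $\alpha,\beta,z\in\mathbb{C}$ with $z\neq0$ and $\alpha,\beta\notin\{0,-1,-2,\dots\}$, and let $$a_j=\frac{(\alpha)_j(\beta)_j}{(-z)^j},\qquad s_n=\sum_{j=0}^n a_j,\qquad j,n\ge 0.$$ For integers $n,k\ge0$ let $$N_n^{(k)}=\sum_{j=0}^k\binom kj(-1)^{k-j}\frac{s_{n+j}}{a_{n+j+1}},\qquad D_n^{(k)}=\sum_{j=0}^k\binom kj(-1)^{k-j}\frac{1}{a_{n+j+1}}$$ be the numerators and denominators of Drummond's sequence transformation of this sequence. Then, for every fixed $n\ge0$, both $Q_n^{(k)}=N_n^{(k)}$ and $Q_n^{(k)}=D_n^{(k)}$ satisfy the recurrence relation in $k$ $$\begin{aligned}&(\alpha+n+k+1)(\beta+n+k+1)\,Q_n^{(k+1)}\\&\quad+\left[z+k(\alpha+\beta+2n+2k+1)+(\alpha+n+k+1)(\beta+n+k+1)\right]Q_n^{(k)}\\&\quad+k(\alpha+\beta+2n+3k)\,Q_n^{(k-1)}+k(k-1)\,Q_n^{(k-2)}=0,\end{aligned}$$ with different initial conditions: for the denominators, the relation holds for all $k\ge0$ with $$D_n^{(0)}=\frac1{a_{n+1}},\qquad D_n^{(-1)}=D_n^{(-2)}=0,$$ and for the numerators, the relation holds for all $k\ge1$ with $$N_n^{(1)}=s_nD_n^{(1)}+\frac{a_{n+1}}{a_{n+2}},\qquad N_n^{(0)}=s_nD_n^{(0)},\qquad N_n^{(-1)}=0.$$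
   Context: $(x)_j=\Gamma(x+j)/\Gamma(x)=x(x+1)\cdots(x+j-1)$ is the Pochhammer symbol (rising factorial), with $(x)_0=1$. Drummond's sequence transformation of a sequence $(a_j)$ with partial sums $s_n$ is $T_n^{(k)}=N_n^{(k)}/D_n^{(k)}$ with $N_n^{(k)}=\Delta^k(s_n/\Delta s_n)$ and $D_n^{(k)}=\Delta^k(1/\Delta s_n)$, where $\Delta f_n=f_{n+1}-f_n$ is the forward difference in $n$ and $\Delta s_n=a_{n+1}$; these are the sums displayed in the claim. Quantities with negative upper index are defined by the stated convention (they are set to $0$). *)

(* Defs.v *)
From mathcomp Require Import all_boot all_order all_algebra.
From mathcomp Require Import reals.
From mathcomp.real_closed Require Export complex.

Set Implicit Arguments.
Unset Strict Implicit.
Unset Printing Implicit Defensive.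

Import GRing.Theory.
Local Open Scope ring_scope.

Section Drummond.
Variable C : fieldType.

Definition pochhammer (x : C) (j : nat) : C := \prod_(i < j) (x + i%:R).

Definition hyp_term (alpha beta z : C) (j : nat) : C :=
  pochhammer alpha j * pochhammer beta j / (- z) ^+ j.

Definition partial_sum (a : nat -> C) (n : nat) : C := \sum_(j < n.+1) a j.

(* The k-th forward difference of f at n, in expanded form.  The order k is an
   integer because the recurrences involve negative orders, where the value
   is 0 by convention. *)
Definition fwd_diff (f : nat -> C) (n : nat) (k : int) : C :=
  match k with
  | Posz m =>
      \sum_(j < m.+1) 'C(m, j)%:R * (-1) ^+ (m - j) * f (n + j)%N
  | Negz _ => 0
  end.

Definition drummond_num (a : nat -> C) : nat -> int -> C :=
  fwd_diff (fun m => partial_sum a m / a m.+1).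

Definition drummond_den (a : nat -> C) : nat -> int -> C :=
  fwd_diff (fun m => 1 / a m.+1).

Definition drummond_rec (alpha beta z : C) (n : nat) (Q : int -> C)
    (k : nat) : Prop :=
  (alpha + n%:R + k%:R + 1) * (beta + n%:R + k%:R + 1) * Q (k%:Z + 1)
  + (z + k%:R * (alpha + beta + 2 * n%:R + 2 * k%:R + 1)
     + (alpha + n%:R + k%:R + 1) * (beta + n%:R + k%:R + 1)) * Q k%:Z
  + k%:R * (alpha + beta + 2 * n%:R + 3 * k%:R) * Q (k%:Z - 1)
  + k%:R * (k%:R - 1) * Q (k%:Z - 2) = 0.

End Drummond.

(* Main.v *)
Require Import Defs.
From mathcomp Require Import all_boot all_order all_algebra.
From mathcomp Require Import reals.
From mathcomp Require Import ring.

(** The terms [a_j] of the series have a rational ratio: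
    [(alpha+m+1) (beta+m+1) a_(m+1) = - z a_(m+2)].  Hence
    [d_m = 1 / a_(m+1)] and [f_m = s_m d_m] solve first-order recurrences in
    [m] with the same operator,
    [P(m) d_(m+1) + z d_m = 0] and [P(m) f_(m+1) + z f_m = - z], where
    [P(m) = (alpha+m+1) (beta+m+1)]; the second follows from the first and
    [s_(m+1) = s_m + a_(m+1)].  Apply the [k]-th forward difference in [m].
    The right-hand sides vanish, the constant [- z] only once [k >= 1], which
    is why the numerators are excluded at [k = 0].  On the left, [P] is a
    product of two linear factors, so the Leibniz rule for a linear factor
    ([fwd_diff_mul_linear]), used twice, expresses the [k]-th difference by
    the differences of orders [k], [k-1], [k-2] of the shifted sequence
    [m |-> f_(m+1)]; since the shift is the identity plus the difference
    ([fwd_diff_shift]), these involve only the orders [k+1] to [k-2] of the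
    sequence itself.  Collecting terms gives Drummond's recurrence
    ([drummond_rec_of_first_order]). *)

Set Implicit Arguments.
Unset Strict Implicit.
Unset Printing Implicit Defensive.

Local Open Scope ring_scope.
Local Open Scope complex_scope.

Import GRing.Theory.

Section ForwardDifference.
Variable C : fieldType.
Implicit Types (f g : nat -> C) (c : C) (n k : nat).

Lemma eq_fwd_diff f g n (k : int) : f =1 g -> fwd_diff f n k = fwd_diff g n k.
Proof. by case: k => k // fg; apply: eq_bigr => j _; rewrite fg. Qed.

Lemma fwd_diffD f g n (k : int) :
  fwd_diff (fun m => f m + g m) n k = fwd_diff f n k + fwd_diff g n k.
Proof.
case: k => k /=; last by rewrite addr0.
by rewrite -big_split; apply: eq_bigr => j _; rewrite mulrDr.
Qed.

Lemma fwd_diffZ c f n (k : int) :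
  fwd_diff (fun m => c * f m) n k = c * fwd_diff f n k.
Proof.
case: k => k /=; last by rewrite mulr0.
by rewrite mulr_sumr; apply: eq_bigr => j _; rewrite mulrCA.
Qed.

Lemma fwd_diff_zero n (k : int) : fwd_diff (fun=> 0 : C) n k = 0.
Proof. by case: k => k //=; rewrite big1 // => j _; rewrite mulr0. Qed.

Lemma fwd_diff0 f n : fwd_diff f n 0 = f n.
Proof. by rewrite /= big_ord1 bin0 expr0 addn0 !mul1r. Qed.

(** Pascal's rule for the binomial coefficients: the closed formula is the
    [k]-fold iteration of the difference operator. *)
Lemma fwd_diffS f n k :
  fwd_diff f n k.+1 = fwd_diff f n.+1 k - fwd_diff f n k.
Proof.
rewrite /= big_ord_recl /= bin0 subn0 addn0.
under eq_bigr => i _ do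
  rewrite /bump /= add1n subSS addnS -addSn binS natrD !mulrDl.
rewrite big_split /= addrA addrC; congr (_ + _).
rewrite big_ord_recr /= bin_small // !mul0r addr0.
rewrite -sumrN [RHS]big_ord_recl /= bin0 subn0 addn0 exprS mulrCA !mulN1r.
rewrite !mul1r mulNr; congr (_ + _); apply: eq_bigr => i _.
rewrite /bump /= add1n addSn addnS -[in LHS](@subnSK i k) // exprS.
by ring.
Qed.

Lemma fwd_diff_cst c n k : (0 < k)%N -> fwd_diff (fun=> c) n k = 0.
Proof.
case: k => // k _; elim: k n => [|k IH] n.
  by rewrite fwd_diffS !fwd_diff0 subrr.
by rewrite fwd_diffS !IH subrr.
Qed.

(** The shift operator is the identity plus the difference operator, and
    commutes with differences. *)
Lemma fwd_diff_shift f n k :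
  fwd_diff (fun m => f m.+1) n k = fwd_diff f n (k%:Z + 1) + fwd_diff f n k.
Proof.
rewrite (_ : k%:Z + 1 = k.+1) ?fwd_diffS ?subrK; last by rewrite -addn1 PoszD.
by apply: eq_bigr => j _; rewrite addSn.
Qed.

(** Leibniz's rule when one factor is linear, so that only its first
    difference, which is [1], contributes.  The factor [k] makes the formula
    correct for [k = 0], where the order [k - 1] is negative. *)
Lemma fwd_diff_mul_linear c g n k :
  fwd_diff (fun m => (c + m%:R) * g m) n k
  = (c + n%:R + k%:R) * fwd_diff g n k + k%:R * fwd_diff g n (k%:Z - 1).
Proof.
elim: k n => [|k IH] n; first by rewrite !fwd_diff0 /=; ring.
rewrite fwd_diffS !IH (_ : k.+1%:Z - 1 = k); last by rewrite -addn1 PoszD addrK.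
rewrite fwd_diffS; case: k {IH} => [|k]; first by rewrite /=; ring.
rewrite (_ : k.+1%:Z - 1 = k); last by rewrite -addn1 PoszD addrK.
by rewrite !fwd_diffS; ring.
Qed.

(** Only [k] times the difference of order [k - 1] ever occurs, so the
    shift rule survives at [k = 0], where it fails for the order [-1] itself. *)
Lemma fwd_diff_shift_pred f n k :
  k%:R * fwd_diff (fun m => f m.+1) n (k%:Z - 1)
  = k%:R * (fwd_diff f n k + fwd_diff f n (k%:Z - 1)).
Proof.
case: k => [|k]; first by rewrite !mul0r.
rewrite (_ : k.+1%:Z - 1 = k); last by rewrite -addn1 PoszD addrK.
by rewrite fwd_diff_shift -PoszD addn1.
Qed.

End ForwardDifference.

Section Drummond.
Variables (C : fieldType) (alpha beta z : C).

(** The left-hand side of Drummond's recurrence is the [k]-th difference of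
    the first-order expression [P(m) f_(m+1) + z f_m]. *)
Lemma drummond_rec_of_first_order (f : nat -> C) (n k : nat) :
  fwd_diff (fun m => (alpha + 1 + m%:R) * ((beta + 1 + m%:R) * f m.+1)
                     + z * f m) n k = 0 ->
  drummond_rec alpha beta z n (fwd_diff f n) k.
Proof.
rewrite fwd_diffD fwd_diffZ (fwd_diff_mul_linear _ (fun m => _ * f m.+1)).
rewrite (fwd_diff_mul_linear _ (fun m => f m.+1)) fwd_diff_shift mulrDr.
rewrite fwd_diff_shift_pred /drummond_rec.
case: k => [|k]; first by move=> <-; rewrite /=; ring.
have predk : k.+1%:Z - 1 = k by rewrite -addn1 PoszD addrK.
have -> : k.+1%:Z - 2 = k%:Z - 1 by rewrite -predk -addrA.
rewrite predk (fwd_diff_mul_linear _ (fun m => f m.+1)) fwd_diff_shift.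
rewrite fwd_diff_shift_pred (_ : k%:Z + 1 = k.+1); last by rewrite -PoszD addn1.
by move=> <-; ring.
Qed.

Hypothesis z_neq0 : z != 0.

Local Notation a := (hyp_term alpha beta z).

Lemma hyp_termS (j : nat) :
  a j.+1 * - z = (alpha + j%:R) * (beta + j%:R) * a j.
Proof.
rewrite /hyp_term /pochhammer !big_ord_recr exprSr /=.
by field; rewrite expf_eq0 oppr_eq0 (negPf z_neq0) andbF.
Qed.

Hypothesis alphaP : forall m : nat, alpha <> - m%:R.
Hypothesis betaP : forall m : nat, beta <> - m%:R.

Lemma hyp_term_neq0 (j : nat) : a j != 0.
Proof.
have shift_neq0 x m : (forall i : nat, x <> - i%:R) -> x + m%:R != 0 :> C.
  by move=> xP; rewrite addr_eq0; apply/eqP.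
rewrite !mulf_neq0 ?invr_eq0 ?expf_neq0 ?oppr_eq0 //;
  by apply/prodf_neq0 => i _; apply: shift_neq0.
Qed.

Lemma inv_hyp_term_first_order (m : nat) :
  (alpha + 1 + m%:R) * ((beta + 1 + m%:R) * (1 / a m.+2)) + z * (1 / a m.+1)
  = 0.
Proof.
have := hyp_termS m.+1; have := hyp_term_neq0 m.+1; have := hyp_term_neq0 m.+2.
set u := a m.+2; set v := a m.+1 => u0 v0 uv.
have -> : z = - ((alpha + m.+1%:R) * (beta + m.+1%:R) * v / u).
  by rewrite -uv mulrAC mulfV // mul1r opprK.
by field; rewrite u0 v0.
Qed.

Lemma partial_sum_over_term_first_order (m : nat) :
  (alpha + 1 + m%:R)
    * ((beta + 1 + m%:R) * (partial_sum a m.+1 / a m.+2))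
  + z * (partial_sum a m / a m.+1) = - z.
Proof.
have [v0 E] := (hyp_term_neq0 m.+1, inv_hyp_term_first_order m).
rewrite {1}/partial_sum big_ord_recr /= -/(partial_sum a m).
set s := partial_sum a m; set v := a m.+1 in v0 E *.
(* The remainder after [s + v] times the relation for the inverses is
   [- z * v / v]. *)
transitivity ((s + v) * ((alpha + 1 + m%:R)
    * ((beta + 1 + m%:R) * (1 / a m.+2)) + z * (1 / v)) - z * (v / v));
  first by rewrite !div1r; ring.
by rewrite E mulr0 add0r mulfV // mulr1.
Qed.

End Drummond.

Theorem theorem3p1 (R : realType) (alpha beta z : R[i])
    (z_neq0 : z <> 0)
    (alphaP : forall m : nat, alpha <> - m%:R)
    (betaP : forall m : nat, beta <> - m%:R)
    (n : nat) :
  let a := hyp_term alpha beta z in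
  let s := partial_sum a in
  let N := drummond_num a in
  let D := drummond_den a in
  ((forall k : nat, drummond_rec alpha beta z n (D n) k)
   /\ D n 0 = 1 / a n.+1
   /\ D n (-1) = 0
   /\ D n (-2) = 0)
  /\
  ((forall k : nat, (1 <= k)%N -> drummond_rec alpha beta z n (N n) k)
   /\ N n 1 = s n * D n 1 + a n.+1 / a n.+2
   /\ N n 0 = s n * D n 0
   /\ N n (-1) = 0).
Proof.
move=> a s N D; have /eqP z0 := z_neq0.
split; split.
- move=> k; apply: drummond_rec_of_first_order.
  rewrite (eq_fwd_diff (g := fun=> 0)) ?fwd_diff_zero // => m.
  exact: inv_hyp_term_first_order.
- by rewrite /D /drummond_den fwd_diff0.
- move=> k k_gt0; apply: drummond_rec_of_first_order.
  rewrite (eq_fwd_diff (g := fun=> - z)) ?fwd_diff_cst // => m.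
  exact: partial_sum_over_term_first_order.
- rewrite /N /D /drummond_num /drummond_den !fwd_diffS !fwd_diff0.
  rewrite {1}/partial_sum big_ord_recr /= -/(partial_sum a n) -/(s n).
  by split; [|split]; rewrite ?div1r //; ring.
Qed.
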